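(* Let $A$ be a normed algebra over $\mathbb{C}$ (not necessarily associative, unital or complete). Suppose that $A$ has no nonzero left linear topological divisors of zero and that $A$ contains at least one left linearly invertible element. Then $A$ is isomorphic, as a $\mathbb{C}$-algebra, to $\mathbb{C}$.
   Context: An algebra over a field $K$ is a $K$-vector space $A$ with a $K$-bilinear product; no associativity, commutativity or unit is assumed. For $x\in A$, $L_x:A\to A$ is $y\mapsto xy$. A $\mathbb{C}$-algebra $A$ is normed if the vector space $A$ carries a norm with $\|xy\|\le\|x\|\,\|y\|$ for all $x,y$. A nonzero element $x\in A$ is left linearly invertible if $L_x$ is a bijective linear map $A\to A$. An element $a\in A$ is a left linear topological divisor of zero if there is a sequence $(x_n)$ in $A$ with $\|x_n\|=1$ for all $n$ and $ax_n\to 0$. *)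

(* Defs.v *)
From mathcomp Require Import all_boot all_order all_algebra.
From mathcomp Require Export sesquilinear.
From mathcomp Require Import all_classical all_reals all_analysis.
From mathcomp Require Export complex.

Set Implicit Arguments.
Unset Strict Implicit.
Unset Printing Implicit Defensive.

Import Order.TTheory GRing.Theory Num.Theory.
Import numFieldNormedType.Exports.

Local Open Scope classical_set_scope.
Local Open Scope ring_scope.

(* The complex numbers are R[i] for R : realType.  A complex algebra is a space A
   with a product mul : {bilinear A -> A -> A}; L_x is the map mul x.  As usual
   for a normedModType over K = R[i], norms take values in K; for the order
   of R[i], `|x| <= `|y| compares them as real numbers. *)

Section NonassociativeNormedAlgebra.
Variables (R : realType) (A : normedModType R[i]) (mul : {bilinear A -> A -> A}).

Definition submultiplicative_norm : Prop :=
  forall x y : A, `|mul x y| <= `|x| * `|y|.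

Definition left_linearly_invertible (x : A) : Prop :=
  x != 0 /\ bijective (mul x).

Definition left_linear_topological_divisor_of_zero (a : A) : Prop :=
  exists x : nat -> A,
    (forall n, `|x n| = 1) /\ mul a (x n) @[n --> \oo] --> (0 : A).

(* R[i]^o is R[i] as a vector space over itself. *)
Definition algebra_isomorphic_to_C : Prop :=
  exists f : {linear A -> R[i]^o},
    bijective f /\ forall x y : A, f (mul x y) = f x * f y.

End NonassociativeNormedAlgebra.

(* Main.v *)
From HB Require Import structures.
Require Import Defs.
From mathcomp Require Import all_boot all_order all_algebra.
From mathcomp Require Import all_classical all_reals all_analysis.
From mathcomp Require Import ring lra.

(* For e left linearly invertible and y in A, the operator T = L_e^-1 L_y is
   bounded, and T - a = L_e^-1 L_(y - a e) is bounded below unless y = a e.  So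
   it suffices that a bounded operator T on a nonzero complex normed space,
   complete or not, is not such that T - a is bounded below for every a.

   Suppose it is, and let m(a) be the best lower bound of T - a.  It is
   1-Lipschitz and tends to infinity, so it has a minimum m0 > 0, and then every
   T - a has dense range (clear for large a, and propagated inwards by steps of
   m0 / 2).  Let m(a) = m0; translate so that a = 0.  With r = m0 / 2 and
   P = X^n - r^n = prod (X - z_j),
     n |T^(n-1) u| = |P'(T) u| <= (sum_j 1 / m(z_j)) |P(T) u|
                  <= (sum_j 1 / m(z_j)) (1 + 2^-n) |T^n u|.
   One of the z_j is r, so m(r) > m0 would lower the sum by a fixed amount
   independent of n, and for large n this beats the error n 2^-n; as T^(n-1)
   has dense range we would get m(0) > m0.  So m(a + m0 / 2) = m0: the minimum
   propagates along a ray to infinity, where m is large. *)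

Set Implicit Arguments.
Unset Strict Implicit.
Unset Printing Implicit Defensive.

Import Order.TTheory GRing.Theory Num.Theory.
Import numFieldNormedType.Exports.
Import Normc.
Local Open Scope classical_set_scope.
Local Open Scope complex_scope.
Local Open Scope ring_scope.

(** * Elementary estimates on real and complex numbers *)

Lemma natr_half_expr_small (R : archiRealFieldType) (d : R) : 0 < d ->
  exists n, (0 < n)%N /\ n%:R * (2^-1) ^+ n < d.
Proof.
move=> d0; set k := (Num.truncn (2 / d)).+1.
have k2 : 2 < k%:R * d.
  by rewrite -ltr_pdivrMr// truncnS_gt.
(* For [n = 2k], [n 2^-n = 2 (k 2^-k)^2 / k <= 2 / k < d], because [k <= 2^k]. *)
exists k.*2; split=> //.
have kq : k%:R * (2^-1 : R) ^+ k <= 1.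
  rewrite exprVn ler_pdivrMr ?exprn_gt0// mul1r -natrX ler_nat ltnW//.
  exact: ltn_expl.
have q0 : 0 <= (2^-1 : R) ^+ k by rewrite exprn_ge0.
have k0 : 0 < k%:R :> R by rewrite ltr0n.
rewrite -addnn natrD exprD.
rewrite -(ltr_pM2l k0); apply: le_lt_trans _ k2.
set x := k%:R in kq k0 *; set y := _ ^+ k in kq q0 *.
have : (x * y) * (x * y) <= 1 * 1 by rewrite ler_pM// mulr_ge0// ltW.
nra.
Qed.

Lemma normcR (R : rcfType) (x : R) : normc x%:C = `|x|.
Proof. by rewrite /normc/= expr0n/= addr0 sqrtr_sqr. Qed.

Lemma normc_ge0 (R : rcfType) (x : R[i]) : 0 <= normc x.
Proof. by case: x => a b; exact: sqrtr_ge0. Qed.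

Lemma normc_distC (R : rcfType) (x y : R[i]) : normc (x - y) = normc (y - x).
Proof. by rewrite -opprB (normcN (_ : R[i])). Qed.

Lemma normc_le_ReIm (R : rcfType) (x y : R) : normc (x +i* y) <= `|x| + `|y|.
Proof.
rewrite -[leRHS]ger0_norm ?addr_ge0// -(sqrtr_sqr (_ + _)); apply: ler_wsqrtr.
by rewrite sqrrD !real_normK ?num_real//= addrAC lerDl mulrn_wge0// mulr_ge0.
Qed.

Lemma normc_walk_ge (R : realType) (a : R[i]) (r M : R) : 0 < r ->
  exists n : nat, M < normc (a + (n%:R * r)%:C).
Proof.
move=> r0; exists (Num.truncn ((M + normc a) / r)).+1.
set n := _.+1.
have nr : M + normc a < n%:R * r by rewrite -ltr_pdivrMr// truncnS_gt.
have := @le_normcD R (a + (n%:R * r)%:C) (- a).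
rewrite (normcN (_ : R[i])) addrAC subrr add0r normcR.
by have := ler_norm (n%:R * r); lra.
Qed.

(** * Polynomials in a linear operator *)

Section PolynomialAction.
Variables (K : comNzRingType) (V : lmodType K) (T : {linear V -> V}).

Definition poly_act (p : {poly K}) (u : V) : V :=
  \sum_(i < size p) p`_i *: iter i T u.

Lemma poly_act_widen n (p : {poly K}) u : (size p <= n)%N ->
  poly_act p u = \sum_(i < n) p`_i *: iter i T u.
Proof.
move=> pn; rewrite /poly_act (big_ord_widen n (fun i => p`_i *: iter i T u) pn).
rewrite [in RHS](bigID (fun i : 'I_n => (i < size p)%N))/=.
rewrite [X in _ = _ + X]big1 ?addr0// => i; rewrite -leqNgt => pi.
by rewrite nth_default// scale0r.
Qed.

Lemma poly_actD p q u : poly_act (p + q) u = poly_act p u + poly_act q u.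
Proof.
set n := maxn (size p) (size q).
rewrite (@poly_act_widen n (p + q)) ?size_polyD//.
rewrite (@poly_act_widen n p) ?leq_maxl// (@poly_act_widen n q) ?leq_maxr//.
by rewrite -big_split; apply: eq_bigr => i _ /=; rewrite coefD scalerDl.
Qed.

Lemma poly_actZ a p u : poly_act (a *: p) u = a *: poly_act p u.
Proof.
rewrite (@poly_act_widen (size p)) ?size_scale_leq// scaler_sumr.
by apply: eq_bigr => i _; rewrite coefZ scalerA.
Qed.

Lemma poly_actXn n u : poly_act 'X^n u = iter n T u.
Proof.
rewrite /poly_act size_polyXn big_ord_recr/= big1 ?add0r => [|i _].
  by rewrite coefXn eqxx scale1r.
by rewrite coefXn ltn_eqF ?scale0r.
Qed.

Lemma poly_actMX p u : poly_act ('X * p) u = T (poly_act p u).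
Proof.
rewrite (@poly_act_widen (size p).+1); last first.
  by apply: leq_trans (size_polyMleq _ _) _; rewrite size_polyX.
rewrite big_ord_recl coefXM scale0r add0r linear_sum.
by apply: eq_bigr => i _; rewrite coefXM/= linearZ.
Qed.

Lemma poly_act_rM p u : poly_act ('X * p) u = poly_act p (T u).
Proof.
rewrite poly_actMX linear_sum; apply: eq_bigr => i _.
by rewrite linearZ/= -iterS iterSr.
Qed.

Lemma poly_actB p u v : poly_act p (u - v) = poly_act p u - poly_act p v.
Proof.
rewrite /poly_act -sumrB; apply: eq_bigr => i _; rewrite -scalerBr; congr (_ *: _).
by elim: (i : nat) => //= n ->; rewrite linearB.
Qed.

Lemma poly_act_scale p a u : poly_act p (a *: u) = a *: poly_act p u.
Proof.
rewrite /poly_act scaler_sumr; apply: eq_bigr => i _.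
have -> : iter i T (a *: u) = a *: iter i T u.
  by elim: (i : nat) => //= n ->; rewrite linearZ.
by rewrite !scalerA mulrC.
Qed.

Lemma poly_act_XsubC a p u :
  poly_act (('X - a%:P) * p) u = T (poly_act p u) - a *: poly_act p u.
Proof.
by rewrite mulrBl mul_polyC -scaleNr poly_actD poly_actMX poly_actZ scaleNr.
Qed.

(** Since [p(T)] commutes with [T - a], the factor can also act first. The logarithmic derivative
    bound needs both orders. *)
Lemma poly_act_XsubCr a p u :
  poly_act (('X - a%:P) * p) u = poly_act p (T u - a *: u).
Proof.
rewrite poly_actB poly_act_scale -poly_act_rM mulrBl mul_polyC.
by rewrite -(scaleNr a p) poly_actD poly_actZ scaleNr.
Qed.

End PolynomialAction.

(** * Operators on a complex space with a real-valued seminorm *)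

Section SeminormedOperators.
Variables (R : realType) (V : lmodType R[i]) (N : V -> R).
Hypothesis ND : forall x y, N (x + y) <= N x + N y.
Hypothesis NZ : forall a x, N (a *: x) = normc a * N x.

Lemma seminorm0 : N 0 = 0.
Proof. by rewrite -(scale0r (0 : V)) NZ normc0 mul0r. Qed.

Lemma seminormZR (r : R) x : N (r%:C *: x) = `|r| * N x.
Proof. by rewrite NZ normcR. Qed.

Lemma seminormN x : N (- x) = N x.
Proof. by rewrite -scaleN1r NZ (normcN (1 : R[i])) normc1 mul1r. Qed.

Lemma seminorm_distC x y : N (x - y) = N (y - x).
Proof. by rewrite -opprB seminormN. Qed.

Lemma seminorm_ge0 x : 0 <= N x.
Proof. by have := ND x (- x); rewrite subrr seminorm0 seminormN; lra. Qed.

Lemma seminormB x y : N (x - y) <= N x + N y.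
Proof. by rewrite -(seminormN y) ND. Qed.

Lemma seminorm_lerB x y : N x - N y <= N (x - y).
Proof. by have := ND (x - y) y; rewrite subrK; lra. Qed.

Lemma seminorm_lerD x y : N x - N y <= N (x + y).
Proof. by have := seminorm_lerB x (- y); rewrite opprK seminormN. Qed.

(** [P'] is the sum of the products [P / (X - a)] over [a] in [s], and the bound for [T - a]
    controls each term by [w a] times [|P(T) u|]. The induction uses
    [((X - a) Q)' = Q + (X - a) Q']. *)
Lemma logarithmic_derivative_bound (T : {linear V -> V}) (w : R[i] -> R) s u :
  (forall a v, a \in s -> N v <= w a * N (T v - a *: v)) ->
  (forall a, 0 <= w a) ->
  let P := \prod_(a <- s) ('X - a%:P) in
  N (poly_act T P^`() u) <= (\sum_(a <- s) w a) * N (poly_act T P u).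
Proof.
move=> ws w0 /=; elim: s ws u => [|a s IH] ws u.
  rewrite !big_nil mul0r derivC /poly_act size_poly0 big_ord0.
  by rewrite seminorm0.
rewrite !big_cons derivM derivXsubC mul1r poly_actD poly_act_XsubCr.
apply: (le_trans (ND _ _)); rewrite mulrDl lerD//.
  by rewrite poly_act_XsubC ws// mem_head.
rewrite poly_act_XsubCr; apply: IH => b v bs.
by apply: ws; rewrite inE bs orbT.
Qed.

Definition dense_range (S : V -> V) :=
  forall v e, 0 < e -> exists u, N (v - S u) < e.

Lemma dense_range_iter (T : {linear V -> V}) (C : R) n : 0 <= C ->
  (forall v, N (T v) <= C * N v) -> dense_range T -> dense_range (iter n T).
Proof.
move=> C0 TC Td; elim: n => [|n IH] v e e0.
  by exists v; rewrite subrr seminorm0.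
have [w vw] := Td v (e / 2) ltac:(lra).
(* The divisor is [C + 1] because [C] may be zero. *)
have [|u wu] := IH w (e / 2 / (C + 1)); first by apply: divr_gt0; lra.
exists u; rewrite /= -(subrK (T w) v) -addrA -linearB.
apply: (le_lt_trans (ND _ _)).
have : C * N (w - iter n T u) <= e / 2.
  apply: (@le_trans _ _ ((C + 1) * (e / 2 / (C + 1)))).
    by apply: ler_pM; rewrite ?seminorm_ge0 ?(ltW wu)//; lra.
  by rewrite mulrC divfK//; lra.
have := TC (w - iter n T u); lra.
Qed.

(** Correcting the remainder [n] times leaves an error of at most [q^n N v], as with partial sums of
    a Neumann series. No limit in [V] is taken, which is why the conclusion is density and not
    surjectivity. *)
Lemma dense_range_contraction (S : {linear V -> V}) (q : R) : 0 <= q < 1 ->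
  (forall v, exists u, N (v - S u) <= q * N v) -> dense_range S.
Proof.
move=> /andP[q0 q1] Sq v e e0.
have it n : exists u, N (v - S u) <= q ^+ n * N v.
  elim: n => [|n [u vu]]; first by exists 0; rewrite linear0 subr0 mul1r.
  have [u' vu'] := Sq (v - S u); exists (u + u').
  rewrite linearD opprD addrA (le_trans vu')// exprS -mulrA.
  by rewrite ler_wpM2l.
have : (fun n => q ^+ n * N v) @ \oo --> (0 * N v : R).
  by apply: cvgMl; apply: cvg_expr; rewrite ger0_norm.
rewrite mul0r => /cvgr0Pnorm_lt/(_ e e0)[n _ /(_ n (leqnn n))/= ne].
have [u vu] := it n; exists u; apply: (le_lt_trans vu).
exact: le_lt_trans (ler_norm _) ne.
Qed.

Lemma bound_of_dense (T : {linear V -> V}) (S : V -> V) (C k : R) : 0 <= C ->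
  (forall v, N (T v) <= C * N v) -> dense_range S -> 0 <= k ->
  (forall u, N (S u) <= k * N (T (S u))) -> forall v, N v <= k * N (T v).
Proof.
move=> C0 TC Sd k0 Sk v; apply/ler_addgt0Pr => e e0.
have D0 : 0 < 1 + k * C by rewrite ltr_wpDr ?mulr_ge0.
(* Replacing [v] by [S u] costs [N (v - S u)] on the left and at most [k C N (v - S u)] on the
   right. *)
have [|u vu] := Sd v (e / (1 + k * C)); first by rewrite divr_gt0.
have h1 := seminorm_lerB v (S u).
have h2 : k * N (T (S u)) <= k * (N (T v) + C * N (v - S u)).
  rewrite ler_wpM2l//; have := seminorm_lerB (T (S u)) (T v).
  by have := TC (S u - v); rewrite (seminorm_distC v) linearB; lra.
have h3 : (1 + k * C) * N (v - S u) <= e.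
  by rewrite mulrC -ler_pdivlMr// ltW.
have := Sk u; lra.
Qed.

End SeminormedOperators.

(** * A minimum principle for lower bounds of [T - a] *)

Section MinimumPrinciple.
Variables (R : realType) (V : lmodType R[i]) (N : V -> R).
Hypothesis ND : forall x y, N (x + y) <= N x + N y.
Hypothesis NZ : forall a x, N (a *: x) = normc a * N x.

Lemma min_principle_at0 (T : {linear V -> V}) (C m0 m1 : R) :
  0 <= C -> (forall v, N (T v) <= C * N v) -> dense_range N T ->
  0 < m0 < m1 ->
  (forall a v, m0 * N v <= N (T v - a *: v)) ->
  (forall v, m1 * N v <= N (T v - (m0 / 2)%:C *: v)) ->
  exists2 m2, m0 < m2 & forall v, m2 * N v <= N (T v).
Proof.
move=> C0 TC Td /andP[m00 m01] Tm Tm1.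
have m10 : 0 < m1 by lra.
set r := (m0 / 2)%:C; set q := (2^-1 : R).
have qn0 k : 0 <= q ^+ k by rewrite exprn_ge0// invr_ge0.
(* The gain at the root [r]: its weight is [1 / m1] instead of [1 / m0], so [m0 * W] drops from [n]
   to at most [n - d]. *)
pose d := 1 - m0 / m1.
have d0 : 0 < d by rewrite subr_gt0 ltr_pdivrMr// mul1r.
have [n [n0 nq]] := natr_half_expr_small d0.
pose w a := if a == r then m1^-1 else m0^-1.
have wm a : w a <= m0^-1.
  by rewrite /w; case: ifP => // _; rewrite lef_pV2 ?posrE// ltW.
have w0 a : 0 < w a by rewrite /w; case: ifP; rewrite invr_gt0.
have wT a v : N v <= w a * N (T v - a *: v).
  rewrite mulrC -ler_pdivrMr// mulrC /w; case: eqP => [->|_];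
    by rewrite invrK.
have [s] := closed_field_poly_normal ('X^n - (r ^+ n)%:P : {poly R[i]}).
rewrite lead_coefXnsubC// scale1r => Ps.
have sn : size s = n.
  by have := size_XnsubC (r ^+ n) n0; rewrite Ps size_prod_XsubC => -[].
have rs : r \in s.
  by rewrite -root_prod_XsubC -Ps rootE !hornerE subrr.
pose W := \sum_(a <- s) w a.
have WE : m0 * W <= n%:R - d.
  rewrite /W (big_rem r)//= mulrDr {1}/w eqxx /d opprB [leRHS]addrC -addrA lerD2l.
  have h s' : \sum_(y <- s') w y <= (size s')%:R / m0.
    elim: s' => [|a s' IH]; first by rewrite big_nil mul0r.
    by rewrite big_cons/= -natr1 mulrDl mul1r addrC lerD.
  apply: (le_trans (ler_wpM2l (ltW m00) (h _))).
  rewrite mulrC divfK ?gt_eqF// size_rem// sn.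
  by rewrite -[in leRHS](prednK n0) -natr1 addrC addrK.
have W0 : 0 < W.
  rewrite /W (big_rem r)//= ltr_wpDr// big_seq sumr_ge0// => a _.
  exact: ltW.
have iterm k v : m0 ^+ k * N v <= N (iter k T v).
  elim: k => [|k IH]; first by rewrite mul1r.
  rewrite exprS -mulrA iterS.
  have := Tm 0 (iter k T v); rewrite scale0r subr0.
  by apply: le_trans; rewrite ler_wpM2l// ltW.
(* Here [P'(T) u = n T^(n-1) u], and [|P(T) u| <= |T^n u| + r^n |u| <= (1 + q^n) |T^n u|] by [iterm]
   and [r = m0 q]. *)
have key u : N (iter n.-1 T u) <=
    (W * (1 + q ^+ n) / n%:R) * N (T (iter n.-1 T u)).
  have := @logarithmic_derivative_bound _ _ _ ND NZ T w s u
    (fun a v _ => wT a v) (fun a => ltW (w0 a)).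
  rewrite /= -Ps derivB derivC subr0 derivXn -scaler_nat poly_actZ NZ.
  have -> : normc n%:R = n%:R :> R.
    by rewrite -(rmorph_nat (real_complex R)) normcR normr_nat.
  rewrite poly_actXn -/W => h.
  rewrite mulrAC ler_pdivlMr ?ltr0n// mulrC (le_trans h)// -mulrA ler_wpM2l//.
    exact: ltW.
  rewrite -iterS prednK// -polyCN -[_%:P]alg_polyC poly_actD poly_actZ.
  rewrite -(expr0 'X) !poly_actXn/= mulrDl mul1r (le_trans (ND _ _))// lerD2l.
  rewrite NZ (normcN (_ : R[i])) -rmorphXn normcR.
  rewrite ger0_norm ?exprn_ge0 ?divr_ge0 ?(ltW m00)//.
  by rewrite exprMn mulrAC mulrC ler_wpM2l.
set k2 := W * (1 + q ^+ n) / n%:R in key.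
have k20 : 0 < k2 by rewrite divr_gt0 ?ltr0n// mulr_gt0// ltr_pwDl.
(* [m0 < 1 / k2] means [m0 W (1 + q^n) < n]. It follows from [(n - d) (1 + q^n) < n], which holds as
   [n q^n < d]. *)
exists k2^-1.
  rewrite -[m0]invrK ltf_pV2 ?posrE ?invr_gt0//.
  rewrite -(ltr_pM2l m00) mulfV ?gt_eqF// mulrA ltr_pdivrMr ?ltr0n// mul1r.
  apply: (@le_lt_trans _ _ ((n%:R - d) * (1 + q ^+ n))).
    by rewrite mulrA ler_wpM2r// addr_ge0.
  have := mulr_ge0 (ltW d0) (qn0 n); lra.
move=> v; rewrite mulrC ler_pdivrMr// mulrC.
move: v; apply: (bound_of_dense ND NZ C0 TC _ (ltW k20) key).
exact: dense_range_iter TC Td.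
Qed.

End MinimumPrinciple.

(** * Existence of an approximate eigenvalue of a bounded operator *)

Section ApproximateEigenvalue.
Variables (R : realType) (V : lmodType R[i]) (N : V -> R).
Hypothesis ND : forall x y, N (x + y) <= N x + N y.
Hypothesis NZ : forall a x, N (a *: x) = normc a * N x.
Variables (T : {linear V -> V}) (C : R).
Hypothesis TC : forall v, N (T v) <= C * N v.
Variable v0 : V.
Hypothesis Nv0 : N v0 = 1.

(* The set is nonempty thanks to v0, so [inf] is not a junk value. *)
Definition lower_bound (a : R[i]) : R :=
  inf [set N (T v - a *: v) | v in [set v | N v = 1]].

Let C0 : 0 <= C.
Proof. by have := TC v0; rewrite Nv0 mulr1; exact/le_trans/seminorm_ge0. Qed.

Lemma lower_boundP a v : lower_bound a * N v <= N (T v - a *: v).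
Proof.
have /orP[/eqP Nv|Nv] : (N v == 0) || (0 < N v).
- by rewrite -le0r seminorm_ge0.
- by rewrite Nv mulr0 seminorm_ge0.
- rewrite -ler_pdivlMr// mulrC.
  have Nv' : `|(N v)^-1| = (N v)^-1 by rewrite ger0_norm// invr_ge0 ltW.
  rewrite -Nv' -(seminormZR NZ) scalerBr scalerA (mulrC _ a) -scalerA -linearZ/=.
  apply: ge_inf.
    by exists 0 => _ [u _ <-]; exact: seminorm_ge0.
  by exists ((N v)^-1%:C *: v) => //=; rewrite seminormZR// Nv' mulVf// gt_eqF.
Qed.

Lemma le_lower_bound a c : (forall v, c * N v <= N (T v - a *: v)) ->
  c <= lower_bound a.
Proof.
move=> cT; apply: lb_le_inf; first by exists (N (T v0 - a *: v0)), v0.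
by move=> _ [v Nv <-]; have := cT v; rewrite Nv mulr1.
Qed.

Lemma lower_bound_lipschitz a b : lower_bound a - normc (a - b) <= lower_bound b.
Proof.
apply: le_lower_bound => v; rewrite mulrBl -NZ.
have -> : T v - b *: v = (T v - a *: v) + (a - b) *: v.
  by rewrite scalerBl addrA subrK.
apply: le_trans (seminorm_lerD ND NZ _ _).
by rewrite lerB// lower_boundP.
Qed.

Lemma lower_bound_far a : normc a - C <= lower_bound a.
Proof.
apply: le_lower_bound => v; rewrite mulrBl -NZ (seminorm_distC NZ).
apply: le_trans (seminorm_lerB ND _ _).
by rewrite lerB// TC.
Qed.

Lemma lower_bound_min :
  exists a, forall b, lower_bound a <= lower_bound b.
Proof.
pose f (p : R * R) := lower_bound (p.1 +i* p.2).
have f_cont : continuous f.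
  move=> p; apply/cvgrPdist_lt => e e0.
  have e20 : 0 < e / 2 by rewrite divr_gt0.
  near=> q.
  have [h1 h2] : ball p (e / 2) q by near: q; exact: (nbhsx_ballx p (e / 2) e20).
  have d : normc ((p.1 +i* p.2) - (q.1 +i* q.2)) < e.
    have -> : (p.1 +i* p.2) - (q.1 +i* q.2) = (p.1 - q.1) +i* (p.2 - q.2) by [].
    apply: (le_lt_trans (normc_le_ReIm _ _)).
    by rewrite (splitr e) ltrD.
  have l1 := lower_bound_lipschitz (p.1 +i* p.2) (q.1 +i* q.2).
  have l2 := lower_bound_lipschitz (q.1 +i* q.2) (p.1 +i* p.2).
  rewrite normc_distC in l2.
  by rewrite /f ltr_distlC; apply/andP; split; lra.
(* Outside the square of half-side [M], [|a| >= M] and so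
   [lower_bound a >= |a| - C > lower_bound 0]; a minimum over the compact square is thus global. *)
pose M := C + lower_bound 0 + 1.
have f0 : 0 <= lower_bound 0.
  by apply: le_lower_bound => v; rewrite mul0r seminorm_ge0.
have M0 : 0 <= M by rewrite /M; have := C0; lra.
pose A := `[- M, M]%classic `*` `[- M, M]%classic : set (R * R).
have A0 : A (0, 0) by split; rewrite /= in_itv/=; apply/andP; split; lra.
have cA : compact A by apply: compact_setX; exact: segment_compact.
have [|c _ fc] := @compact_EVT_min (R * R)%type R f A (ex_intro _ _ A0) cA.
  exact: continuous_subspaceT.
exists (c.1 +i* c.2) => -[x y].
have [xyA|] := pselect (A (x, y)); first by have := fc (x, y) (mem_set xyA).
move=> xyA; apply: (@le_trans _ _ (lower_bound 0)).
  exact: fc (0, 0) (mem_set A0).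
apply: le_trans (lower_bound_far _).
have nc1 : `|x| <= normc (x +i* y).
  by rewrite -sqrtr_sqr /normc; apply: ler_wsqrtr; rewrite lerDl sqr_ge0.
have nc2 : `|y| <= normc (x +i* y).
  by rewrite -sqrtr_sqr /normc; apply: ler_wsqrtr; rewrite lerDr sqr_ge0.
have [Mn|nM] := leP M (normc (x +i* y)); first by rewrite /M in Mn; lra.
case: xyA; split; rewrite /= in_itv/= -ler_norml.
  exact/ltW/(le_lt_trans nc1).
exact/ltW/(le_lt_trans nc2).
Unshelve. all: by end_near.
Qed.

Definition shift_op (a : R[i]) : {linear V -> V} :=
  T \- ( *:%R a : V -> V).

Lemma shift_opD a b v : shift_op (a + b) v = shift_op a v - b *: v.
Proof. by rewrite /= scalerDl opprD addrA. Qed.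

(** The vector [- v / a] is an approximate preimage of [v], with error [T v / a] of relative size at
    most [C / |a| < 1]. *)
Lemma dense_range_shift_op_far a : C < normc a -> dense_range N (shift_op a).
Proof.
move=> Ca; have na : 0 < normc a by exact: le_lt_trans Ca.
have a0 : a != 0 by apply: contraTneq na => ->; rewrite normc0 ltxx.
apply: (dense_range_contraction (q := C / normc a)).
  by apply/andP; split; [rewrite divr_ge0 // ltW|rewrite ltr_pdivrMr // mul1r].
move=> v; exists (- (a^-1 *: v)).
rewrite /= linearN linearZ/= scalerN scalerA mulfV// scale1r !opprB opprK.
rewrite addrA subrr add0r NZ normcV.
by rewrite [leRHS]mulrAC [leRHS]mulrC ler_wpM2l ?invr_ge0 ?(ltW na).
Qed.

Lemma dense_range_shift_op_step c a : 0 < c ->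
  (forall v, c * N v <= N (shift_op a v)) ->
  dense_range N (shift_op a) -> dense_range N (shift_op (a - (c / 2)%:C)).
Proof.
(* Take [u] with [(T - a) u] within [|v| / 4] of [v]. Then [c |u| <= 5/4 |v|], so the extra term
   [(c / 2) u] adds at most [5/8 |v|], and [1/4 + 5/8 = 7/8]. *)
move=> c0 ca da; apply: (dense_range_contraction (q := 7 / 8)); first lra.
move=> v; have [Nv|Nv] := leP (N v) 0.
  exists 0; rewrite linear0 subr0; have := seminorm_ge0 ND NZ v; lra.
have [u vu] := da v (N v / 4) ltac:(lra); exists u.
rewrite shift_opD scaleNr opprK opprD addrA.
apply: (le_trans (seminormB ND NZ _ _)).
rewrite (seminormZR NZ) ger0_norm ?divr_ge0 ?ltW//.
have := ca u; have := seminorm_lerB ND (shift_op a u) v.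
rewrite (seminorm_distC NZ _ v); lra.
Qed.

(** Density holds far out on the horizontal ray from [a]; the uniform bound [c] allows a return to
    [a] in finitely many steps of length [c / 2]. *)
Lemma dense_range_shift_op c a : 0 < c ->
  (forall b, c <= lower_bound b) -> dense_range N (shift_op a).
Proof.
move=> c0 cb.
have c20 : 0 < c / 2 by rewrite divr_gt0.
have [n nC] := normc_walk_ge a C c20.
have {nC} := dense_range_shift_op_far nC.
elim: n => [|n IH] dn; first by rewrite mul0r addr0 in dn.
apply: IH; have -> : a + (n%:R * (c / 2))%:C =
    a + (n.+1%:R * (c / 2))%:C - (c / 2)%:C.
  by rewrite -[n.+1%:R]natr1 mulrDl mul1r rmorphD/= addrA addrK.
apply: dense_range_shift_op_step => // v.
apply: le_trans (lower_boundP _ _).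
by rewrite ler_wpM2r// seminorm_ge0.
Qed.

(** A strictly larger value at the new point would, by the minimum principle applied to [T - a],
    give a better bound at [a] itself. *)
Lemma min_lower_bound_walk a : (forall b, lower_bound a <= lower_bound b) ->
  0 < lower_bound a ->
  lower_bound (a + (lower_bound a / 2)%:C) = lower_bound a.
Proof.
move=> amin a0; apply/eqP; rewrite eq_le amin andbT leNgt; apply/negP => m1.
have [|v|||b v|v|m2 m02 m2T] := @min_principle_at0 _ _ N ND NZ (shift_op a)
    (C + normc a) (lower_bound a) (lower_bound (a + (lower_bound a / 2)%:C)).
- by rewrite addr_ge0// normc_ge0.
- rewrite mulrDl -NZ; apply: (le_trans (seminormB ND NZ _ _)).
  by rewrite lerD2r.
- exact: dense_range_shift_op a0 amin.
- by rewrite a0.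
- rewrite -shift_opD; apply: le_trans (lower_boundP _ _).
  by rewrite ler_wpM2r// seminorm_ge0.
- by rewrite -shift_opD lower_boundP.
- by have := le_lower_bound m2T; rewrite leNgt m02.
Qed.

(** A positive minimum would persist at all points of a ray going to infinity, against the growth of
    [lower_bound] there. *)
Lemma exists_approximate_eigenvalue :
  exists a, forall c, (forall v, c * N v <= N (T v - a *: v)) -> c <= 0.
Proof.
have [a amin] := lower_bound_min.
have [a0|a0] := leP (lower_bound a) 0.
  by exists a => c /le_lower_bound ca; exact: le_trans a0.
have walk n : lower_bound (a + (n%:R * (lower_bound a / 2))%:C) = lower_bound a.
  elim: n => [|n IH]; first by rewrite mul0r addr0.
  rewrite -[n.+1%:R]natr1 mulrDl mul1r rmorphD/= addrA -{2}IH.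
  by rewrite min_lower_bound_walk IH//.
have [n] := normc_walk_ge a (lower_bound a + C) (divr_gt0 a0 (ltr0Sn _ 1)).
have := lower_bound_far (a + (n%:R * (lower_bound a / 2))%:C).
by rewrite walk; lra.
Qed.

End ApproximateEigenvalue.

(** * The norm of [A] as a real-valued function *)

Section RealNorm.
Variables (R : realType) (A : normedModType R[i]).

Definition real_norm (x : A) : R := complex.Re `|x|.

Lemma normr_real_norm x : `|x| = (real_norm x)%:C.
Proof. by rewrite RRe_real// normr_real. Qed.

Lemma real_normD x y : real_norm (x + y) <= real_norm x + real_norm y.
Proof. by rewrite -lecR rmorphD/= -!normr_real_norm ler_normD. Qed.

Lemma real_normZ a x : real_norm (a *: x) = normc a * real_norm x.
Proof.
apply: (@complexI R); rewrite rmorphM/= -!normr_real_norm.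
exact: normrZ.
Qed.

Lemma real_norm_gt0 x : (0 < real_norm x) = (x != 0).
Proof. by rewrite -(ltcR 0) -normr_real_norm normr_gt0. Qed.

End RealNorm.

(** * Left multiplications in an algebra without topological divisors of zero *)

Section NoTopologicalDivisors.
Variables (R : realType) (A : normedModType R[i]) (mul : {bilinear A -> A -> A}).
Local Notation N := (@real_norm R A).
Hypothesis norm_mul : submultiplicative_norm mul.
Hypothesis no_tdz : forall a : A,
  left_linear_topological_divisor_of_zero mul a -> a = 0.

Lemma real_norm_mul x y : N (mul x y) <= N x * N y.
Proof. by rewrite -lecR rmorphM/= -!normr_real_norm norm_mul. Qed.

Lemma mul_bounded_below a : a != 0 ->
  exists2 c, 0 < c & forall x, c * N x <= N (mul a x).
Proof.
move=> a0; apply: contrapT => nc; apply/(negP a0)/eqP/no_tdz.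
have /choice[x xP] (n : nat) : exists x, N (mul a x) < n.+1%:R^-1 * N x.
  apply: contrapT => nx; apply: nc; exists n.+1%:R^-1 => // x.
  by rewrite leNgt; apply/negP => xn; apply: nx; exists x.
have Nx n : 0 < N (x n).
  have := seminorm_ge0 (@real_normD R A) (@real_normZ R A) (mul a (x n)).
  by move=> /le_lt_trans/(_ (xP n)); rewrite pmulr_rgt0.
have Nx' n : `|(N (x n))^-1| = (N (x n))^-1 by rewrite ger0_norm// invr_ge0 ltW.
(* Normalising the vectors that violate the bounds [1 / (n + 1)] gives a sequence of unit vectors
   whose images under [mul a] tend to zero. *)
exists (fun n => (N (x n))^-1%:C *: x n); split=> [n|].
  by rewrite normr_real_norm real_normZ normcR Nx' mulVf// gt_eqF.
apply/cvgr0Pnorm_lt => eps eps0.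
have epsE : eps = (complex.Re eps)%:C by rewrite RRe_real// gtr0_real.
have e0 : 0 < complex.Re eps by rewrite -(ltcR 0) -epsE.
near=> n.
rewrite epsE normr_real_norm ltcR linearZr_LR/= real_normZ normcR Nx'.
rewrite mulrC ltr_pdivrMr//; apply: (lt_trans (xP n)).
rewrite ltr_pM2r//.
near: n; exact: near_infty_natSinv_lt (PosNum e0).
Unshelve. all: by end_near.
Qed.

Lemma scalar_multiple_of_invertible e : left_linearly_invertible mul e ->
  forall y, exists a, y = a *: e.
Proof.
move=> [e0 [g mulK gK]] y; apply: contrapT => ye.
have g_lin : linear g by exact: (can2_linear mulK gK).
pose G : {linear A -> A} := HB.pack g (GRing.isLinear.Build _ _ _ _ g g_lin).
pose T : {linear A -> A} := G \o mul y.
have [ce ce0 ceP] := mul_bounded_below e0.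
have eT v : mul e (T v) = mul y v by exact: gK.
have TC v : N (T v) <= N y / ce * N v.
  rewrite mulrAC ler_pdivlMr// mulrC (le_trans (ceP _))// eT.
  exact: real_norm_mul.
have Ne : 0 < N e by rewrite real_norm_gt0.
have Nv0 : N ((N e)^-1%:C *: e) = 1.
  by rewrite real_normZ normcR ger0_norm ?invr_ge0 ?(ltW Ne)// mulVf// gt_eqF.
have [a aP] := exists_approximate_eigenvalue
  (@real_normD R A) (@real_normZ R A) TC Nv0.
have yae : y - a *: e != 0.
  by rewrite subr_eq0; apply/eqP => yae; apply: ye; exists a.
have [c c0 cP] := mul_bounded_below yae.
(* [c |v| <= |(y - a e) v| = |e (T v - a v)| <= |e| |T v - a v|], so [c / N e] is a positive lower
   bound, which the choice of [a] forbids. *)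
have := aP (c / N e); rewrite leNgt divr_gt0// => /(_ _)/negP; apply=> //.
move=> v; rewrite mulrAC ler_pdivrMr// mulrC [leRHS]mulrC.
apply: le_trans (real_norm_mul _ _); rewrite mulrC (le_trans (cP v))//.
by rewrite linearBl linearZl_LR/= linearBr linearZr_LR/= eT.
Qed.

End NoTopologicalDivisors.

(** * Identification of the line spanned by [e] with the complex numbers *)

Theorem mainTheorem1 (R : realType) (A : normedModType R[i])
    (mul : {bilinear A -> A -> A})
    (norm_mul : submultiplicative_norm mul)
    (no_tdz : forall a : A,
        left_linear_topological_divisor_of_zero mul a -> a = 0)
    (has_inv : exists x : A, left_linearly_invertible mul x) :
  algebra_isomorphic_to_C mul.
Proof.
have [e eI] := has_inv.
have Ce := scalar_multiple_of_invertible norm_mul no_tdz eI.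
case: eI => e0 /bij_inj mulI.
have [mu eeE] := Ce (mul e e).
have mu0 : mu != 0.
  apply: contraNneq e0 => mu0; apply/eqP/mulI.
  by rewrite eeE mu0 scale0r linear0r.
(* Since [e e = mu e], the element [e / mu] is idempotent, so [h] respects products. *)
pose h (z : R[i]^o) : A := (z / mu) *: e.
have h_lin : linear h.
  by move=> a x y; rewrite /h scalerA -scalerDl mulrDl mulrA.
pose H : {linear R[i]^o -> A} := HB.pack h (GRing.isLinear.Build _ _ _ _ h h_lin).
have /choice[f fK] (y : A) : exists z, h z = y.
  have [a ->] := Ce y; exists (a * mu); by rewrite /h mulfK.
have hK : cancel h f.
  move=> z; have : h (f (h z)) = h z by rewrite fK.
  move=> /eqP; rewrite -subr_eq0 -scalerBl scaler_eq0 (negPf e0) orbF subr_eq0.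
  by move=> /eqP/(mulIf (invr_neq0 mu0)).
have f_lin : linear f by exact: (@can2_linear _ _ _ H f hK fK).
pose F : {linear A -> R[i]^o} := HB.pack f (GRing.isLinear.Build _ _ _ _ f f_lin).
exists F; split; first by exists h.
move=> x y; apply: (can_inj hK); rewrite /= fK -{1}(fK x) -{1}(fK y) /h.
rewrite linearZl_LR/= linearZr_LR/= eeE !scalerA.
by congr (_ *: _); field.
Qed.
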